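(* Let $n\ge 5$ and $2\le k<n$. If $k$ divides $n$, then $\rho(\mathrm{PX}(n,k))=\lceil n/k\rceil+1=n/k+1$.
   Context: For integers $n\ge 3$ and $1\le k<n$, the Praeger–Xu graph $\mathrm{PX}(n,k)$ is the simple graph with vertex set $\mathbb Z_n\times\mathbb Z_2^k$; a vertex is written $(i,x)$ with $x=x_0x_1\cdots x_{k-1}$ a bitstring of length $k$. Two vertices $(i,x)$ and $(j,y)$ are adjacent if and only if (after possibly swapping the two vertices) $j=i+1$ in $\mathbb Z_n$ and $x=az_1\cdots z_{k-1}$, $y=z_1\cdots z_{k-1}b$ for some bits $a,b,z_1,\dots,z_{k-1}\in\mathbb Z_2$. For $n\ge5$, $k\ge 2$ the graph $\mathrm{PX}(n,k)$ admits a 2-coloring of its vertices preserved (class-wise) only by the identity automorphism; $\rho(G)$ denotes the minimum size of a color class over all such 2-colorings of $G$. *)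

(* Defs.v *)
From mathcomp Require Import all_boot all_order all_algebra all_fingroup.

Set Implicit Arguments.
Unset Strict Implicit.
Unset Printing Implicit Defensive.

(* A simple graph on a finite type is given by its adjacency relation. *)
Section Cost.
Variables (T : finType) (e : rel T).

Definition graph_aut : {set {perm T}} :=
  [set s : {perm T} | [forall x, forall y, e (s x) (s y) == e x y]].

Definition color_class (c : {ffun T -> bool}) (b : bool) : {set T} :=
  [set x | c x == b].

(* Colors may not be exchanged: each class is mapped onto itself. *)
Definition preserves_coloring (s : {perm T}) (c : {ffun T -> bool}) : bool :=
  [forall b : bool, s @: color_class c b == color_class c b].

Definition distinguishing (c : {ffun T -> bool}) : bool :=
  [forall s in graph_aut, preserves_coloring s c ==> (s == 1%g)].

(* The default #|T|.+1, larger than every color class, is the value of [rho]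
   exactly when there is no distinguishing 2-coloring. *)
Definition rho : nat :=
  \big[minn/#|T|.+1]_(p : {ffun T -> bool} * bool | distinguishing p.1)
     #|color_class p.1 p.2|.

Lemma rho_le c b : distinguishing c -> rho <= #|color_class c b|.
Proof.
move=> dc; rewrite /rho; have := mem_index_enum (c, b).
elim: (index_enum _) => // p r IHr; rewrite inE big_cons => /orP[/eqP <-|/IHr le].
  by rewrite dc geq_minl.
by case: ifP => // _; apply: leq_trans (geq_minr _ _) le.
Qed.

Lemma rho_attained c0 : distinguishing c0 ->
  exists2 c, distinguishing c & exists b, rho = #|color_class c b|.
Proof.
move=> d0.
have: rho <= #|T| by apply: leq_trans (rho_le true d0) (max_card _).
rewrite /rho.
apply: (big_ind (fun m => m <= #|T| ->
  exists2 c, distinguishing c & exists b, m = #|color_class c b|)).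
- by rewrite ltnn.
- by move=> m p Hm Hp; rewrite /minn; case: ifP.
- by move=> [c b] /= dc _; exists c => //; exists b.
Qed.

Lemma rho_none : (forall c, ~~ distinguishing c) -> rho = #|T|.+1.
Proof. by move=> H; rewrite /rho big_pred0 // => -[c b]; apply: negbTE (H c). Qed.

End Cost.

(* 'Z_n is the ring of integers modulo n only for 1 < n. *)
Definition PX_arc n k (u v : 'Z_n * k.-tuple bool) : bool :=
  (v.1 == u.1 + 1)%R &&
  [exists a : bool, exists b : bool, exists z : k.-1.-tuple bool,
     (tval u.2 == a :: z) && (tval v.2 == rcons z b)].

Definition PX n k : rel ('Z_n * k.-tuple bool) :=
  fun u v => PX_arc u v || PX_arc v u.
Arguments PX n k : clear implicits.

Lemma PX_sym n k : symmetric (PX n k).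
Proof. by move=> u v; rewrite /PX orbC. Qed.

Lemma PX_irrefl n k : irreflexive (PX n k).
Proof.
move=> u; rewrite /PX orbb /PX_arc -[X in X == _]GRing.addr0.
by rewrite (inj_eq (GRing.addrI _)) eq_sym GRing.oner_eq0.
Qed.

(* Main.v *)
Require Import Defs.
From mathcomp Require Import all_boot all_order all_algebra all_fingroup.

(* A vertex (i, x) of PX(n, k) assigns bits to the window i, ..., i + k - 1 of
   Z_n, and every shift of Z_n combined with flips of the bits at chosen
   positions is an automorphism.

   Lower bound: a position covered by no window of the color class S could be
   flipped, so the windows of S cover Z_n and |S| >= n/k. If |S| = n/k they
   tile Z_n, and the shift by k with suitable flips is a nontrivial automorphism
   preserving S.

   Upper bound: S consists of the n/k zero vertices at the multiples of k and
   of (1, 0...01). For n >= 5 the 4-cycles are the K_{2,2} between consecutive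
   levels, so at each vertex an automorphism respects the partition of the
   neighbors into in- and out-neighbors; by connectedness it preserves or
   reverses all arcs, and acts on the levels by i |-> c + i or i |-> c - i. The
   only arc inside S goes from (0, 0...0) to (1, 0...01), whence c = 0, or c = 1
   in the reversing case, where level k would go to level 1 - k, which does not
   occur in S. An arc-preserving automorphism that fixes the levels acts on the
   bit at each position of Z_n separately, so it is the identity as soon as it
   fixes the zero vertices of S, whose windows cover Z_n. *)

Set Implicit Arguments.
Unset Strict Implicit.
Unset Printing Implicit Defensive.

Import GRing.Theory.

(** * Color-preserving automorphisms of a graph *)

Section Distinguishing.
Variables (T : finType) (e : rel T).
Implicit Types (c : {ffun T -> bool}) (s : {perm T}).

Lemma graph_autP s :
  reflect (forall x y, e (s x) (s y) = e x y) (s \in graph_aut e).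
Proof.
rewrite inE; apply: (iffP forallP) => [H x y | H x].
  by apply/eqP; move/forallP: (H x).
by apply/forallP => y; rewrite H.
Qed.

Lemma preserves_coloringP s c :
  reflect (forall x, c (s x) = c x) (preserves_coloring s c).
Proof.
apply: (iffP forallP) => [H x | H b].
  have: s x \in s @: color_class c (c x) by rewrite mem_imset ?inE //; apply: perm_inj.
  by rewrite (eqP (H _)) inE => /eqP.
rewrite eqEcard card_imset ?leqnn ?andbT; last exact: perm_inj.
by apply/subsetP => _ /imsetP[x + ->]; rewrite !inE H.
Qed.

(** An injection of a finite class into itself is onto, so the other class is preserved too. *)
Lemma distinguishing_stable c b s : distinguishing e c -> s \in graph_aut e ->
  (forall x, c x = b -> c (s x) = b) -> s = 1%g.
Proof.
move=> /forallP /(_ s) /implyP dc sA H; apply/eqP; apply: (implyP (dc sA)).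
have sE : s @: color_class c b = color_class c b.
  apply/eqP; rewrite eqEcard card_imset ?leqnn ?andbT; last exact: perm_inj.
  by apply/subsetP => _ /imsetP[x + ->]; rewrite !inE => /eqP /H ->.
apply/preserves_coloringP => x.
have: (s x \in s @: color_class c b) = (x \in color_class c b).
  by apply: mem_imset; apply: perm_inj.
by rewrite sE !inE; case: (c x); case: (c (s x)); case: b {sE H dc}.
Qed.

Lemma distinguishing_set (A : {set T}) :
  (forall s, s \in graph_aut e -> (forall x, (s x \in A) = (x \in A)) ->
     s = 1%g) ->
  distinguishing e [ffun x => x \in A].
Proof.
move=> H; apply/forallP => s; apply/implyP => sA; apply/implyP.
move=> /preserves_coloringP sP; apply/eqP; apply: H => // x.
by have := sP x; rewrite !ffunE.
Qed.

End Distinguishing.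

(** * Congruences between naturals cast to Z_n *)

Lemma Zp_natr_eq n (n_gt1 : 1 < n) a b :
  (a%:R == b%:R :> 'Z_n)%R = (a == b %[mod n]).
Proof. by rewrite -(inj_eq val_inj) /= !val_Zp_nat. Qed.

Lemma Zp_natr_small n (n_gt1 : 1 < n) a b : a < n -> b < n ->
  (a%:R = b%:R :> 'Z_n)%R -> a = b.
Proof.
by move=> an bn /eqP; rewrite Zp_natr_eq // !modn_small // => /eqP.
Qed.

Lemma Zp_natr_eq_dvd n k (n_gt1 : 1 < n) a b : k %| n ->
  (a%:R = b%:R :> 'Z_n)%R -> a = b %[mod k].
Proof.
move=> kn /eqP; rewrite Zp_natr_eq // => /eqP E.
by rewrite -(modn_dvdm a kn) E modn_dvdm.
Qed.

(** * Windows, arcs and directed paths in PX(n, k) *)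

Section PraegerXu.
Variables n k : nat.
Local Notation V := ('Z_n * k.-tuple bool)%type.
Implicit Types (u v w x y z t : V) (s : {perm V}).
Local Notation bit v p := (nth false (tval v.2) p).

Definition vertex (i : 'Z_n) (g : nat -> bool) : V :=
  (i, [tuple of mkseq g k]).

Lemma bit_vertex i g p : p < k -> bit (vertex i g) p = g p.
Proof. by move=> pk; rewrite nth_mkseq. Qed.

Lemma vertex_ext u v : u.1 = v.1 ->
  (forall p, p < k -> bit u p = bit v p) -> u = v.
Proof.
case: u v => i x [j y] /= <- H; congr (_, _); apply: val_inj => /=.
by apply: (@eq_from_nth _ false); rewrite ?size_tuple // => p; apply: H.
Qed.

Lemma PX_arcP u v : 0 < k ->
  reflect ((v.1 = u.1 + 1)%R /\
           forall p, p.+1 < k -> bit u p.+1 = bit v p)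
          (PX_arc u v).
Proof.
move=> k_gt0; apply: (iffP andP) => -[].
  move=> /eqP-> /existsP[a /existsP[b /existsP[z /andP[/eqP-> /eqP->]]]].
  split=> // p pk; rewrite /= nth_rcons size_tuple.
  by rewrite -ltnS prednK // pk.
move=> -> H; split=> //.
have szu := size_tuple u.2; have szv := size_tuple v.2.
have szb : size (behead (tval u.2)) == k.-1 by rewrite size_behead szu.
apply/existsP; exists (head false u.2); apply/existsP; exists (last false v.2).
apply/existsP; exists (Tuple szb) => /=; apply/andP; split; apply/eqP.
  by case: (tval u.2) szu k_gt0 => [<-|].
apply: (@eq_from_nth _ false) => [|p].
  by rewrite size_rcons (eqP szb) prednK // szv.
rewrite szv => pk; rewrite nth_rcons (eqP szb) nth_behead.
case: ltngtP => [pk1|pk1|->].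
- by rewrite H // -ltn_predRL.
- by have := leq_ltn_trans pk1 pk; rewrite prednK // ltnn.
- by have := nth_last false v.2; rewrite szv.
Qed.

(* Existence of a directed path of length [q] from [u] to [v]. *)
Definition shifted q u v : Prop :=
  (v.1 = u.1 + q%:R)%R /\ forall p, p + q < k -> bit u (p + q) = bit v p.

Lemma shifted0 u v : shifted 0 u v -> u = v.
Proof.
move=> [E H]; apply: vertex_ext; first by rewrite E addr0.
by move=> p pk; have := H p; rewrite addn0; apply.
Qed.

Lemma shiftedS q u v : 0 < k -> shifted q.+1 u v ->
  exists2 w, PX_arc u w & shifted q w v.
Proof.
move=> k_gt0 [E H].
(* The new last bit has to become bit [k.-1 - q] of [v] after [q] further steps; for [q > k.-1] any
   value would do. *)
exists (vertex (u.1 + 1)%R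
          (fun p => if p.+1 < k then bit u p.+1 else bit v (k.-1 - q))).
  apply/PX_arcP => //; split=> // p pk.
  by rewrite bit_vertex ?pk // ltnW.
split; first by rewrite E -natr1 /= -addrA [(1 + _)%R]addrC.
move=> p pk; rewrite bit_vertex //; case: ltnP => pk1.
  by rewrite -addnS H // addnS.
have <- : p + q = k.-1 by apply/eqP; rewrite -eqSS prednK // eqn_leq pk pk1.
by rewrite addnK.
Qed.

(** Directed paths of length at least k are constrained by levels only; adding n to the level
    difference makes the path long enough. *)
Lemma PX_invariant_const (T : Type) (f : V -> T) : 1 < n -> 0 < k -> k <= n ->
  (forall u v, PX_arc u v -> f u = f v) -> forall u v, f u = f v.
Proof.
move=> n_gt1 k_gt0 kn fP u v.
have: shifted ((v.1 - u.1)%R + n) u v.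
  split; last first.
    move=> p; rewrite ltnNge => /negP[]; apply: leq_trans kn _.
    by rewrite addnA leq_addl.
  rewrite natrD pchar_Zp // addr0.
  by rewrite [(_ *+ _)%R]natr_Zp addrC subrK.
move: (_ + n) => q; elim: q u => [|q IHq] u; first by move/shifted0->.
by case/shiftedS => // w /fP-> /IHq.
Qed.

Lemma shifted_morph (f : V -> V) q u v : 0 < k ->
  (forall x y, PX_arc x y -> PX_arc (f x) (f y)) ->
  shifted q u v -> shifted q (f u) (f v).
Proof.
move=> k_gt0 fP; elim: q u => [|q IHq] u.
  by move/shifted0->; split=> [|p]; rewrite ?addr0 // addn0.
case/shiftedS => // w /fP /PX_arcP[] // Ew Hw /IHq[Ev Hv].
split; first by rewrite Ev Ew -natr1 -addrA [(1 + _)%R]addrC.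
move=> p pk; rewrite addnS in pk *.
by rewrite Hw // Hv // ltnW.
Qed.

(* [u] and [v] are joined by a zigzag of directed paths, all of whose vertices
   see the position [u.1 + p = v.1 + q] of Z_n; the middle path goes from a
   vertex [y] having that position last to a vertex [z] having it first. *)
Lemma bit_morph (f : V -> V) u v p q : 0 < k ->
  (forall x y, PX_arc x y -> PX_arc (f x) (f y)) ->
  p < k -> q < k -> (u.1 + p%:R = v.1 + q%:R)%R -> bit u p = bit v q ->
  bit (f u) p = bit (f v) q.
Proof.
move=> k_gt0 fP pk qk E B.
pose r := k.-1 - q.
have rq : q + r = k.-1 by rewrite subnKC // -ltnS prednK.
have kk : k.-1 < k by rewrite prednK.
pose z := vertex (u.1 + p%:R)%R (fun i => bit u (i + p)).
pose y := vertex (v.1 - r%:R)%R (fun i => bit v (i - r)).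
have uz : shifted p u z.
  by split=> // i ip; rewrite bit_vertex // (leq_ltn_trans _ ip) // leq_addr.
have yv : shifted r y v.
  by split=> [|i ir]; rewrite ?subrK // bit_vertex // addnK.
(* The two windows share a single position, so only index 0 is compared. *)
have yz : shifted k.-1 y z.
  split=> [|i ik]; first by rewrite /= -rq natrD E [(q%:R + _)%R]addrC addrA subrK.
  have i0 : i = 0.
    by apply/eqP; rewrite -leqn0 -ltnS -(ltn_add2r k.-1) add1n prednK.
  by rewrite !bit_vertex ?i0 // !add0n -rq addnK B.
have [_ /(_ 0 pk)] := shifted_morph k_gt0 fP uz; rewrite add0n => ->.
have [_ /(_ 0 kk)] := shifted_morph k_gt0 fP yz; rewrite add0n => <-.
have [_ /(_ q)] := shifted_morph k_gt0 fP yv; rewrite rq; exact.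
Qed.

(** * Four-cycles and the orientation of edges *)

Section Orientation.
Hypotheses (n_ge5 : 5 <= n) (k_ge2 : 2 <= k).

Let n_gt1 : 1 < n. Proof. exact: leq_trans n_ge5. Qed.
Let k_gt0 : 0 < k. Proof. exact: ltnW. Qed.

Let natr_neq0 a : 0 < a < 5 -> (a%:R != 0 :> 'Z_n)%R.
Proof.
case/andP=> a0 a5; apply/eqP => /(@Zp_natr_small _ n_gt1 a 0).
rewrite (leq_trans a5) // ltnW // => /(_ isT isT) E.
by rewrite E in a0.
Qed.

Lemma PX_arc_level u v : PX_arc u v -> (v.1 = u.1 + 1)%R.
Proof. by case/andP=> /eqP. Qed.

Lemma PX_arc_asym u v : PX_arc u v -> ~~ PX_arc v u.
Proof.
move=> /PX_arc_level E; apply/negP => /PX_arc_level /eqP.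
rewrite E -addrA -[X in X == _]addr0 (inj_eq (addrI _)) eq_sym.
exact/negP/(natr_neq0 (isT : 0 < 2 < 5)).
Qed.

Lemma PX_arcC u v : PX n k u v -> PX_arc v u = ~~ PX_arc u v.
Proof. by case/orP => a; rewrite a (negbTE (PX_arc_asym a)). Qed.

(** Out-neighbors do not see the first bit of [u], so it can be flipped; in-neighbors likewise do
    not see the last bit. *)
Lemma PX_square_out u v x : PX_arc u v -> PX_arc u x ->
  exists2 t, t != u & PX_arc t v && PX_arc t x.
Proof.
move=> /PX_arcP[] // Ev Hv /PX_arcP[] // Ex Hx.
pose t := vertex u.1 (fun p => if p == 0 then ~~ bit u p else bit u p).
exists t.
  apply/eqP => /(congr1 (fun w => bit w 0)); rewrite bit_vertex //=.
  by case: (bit u 0).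
apply/andP; split; apply/PX_arcP => //; split=> // p pk.
  by rewrite bit_vertex //= Hv.
by rewrite bit_vertex //= Hx.
Qed.

Lemma PX_square_in u v x : PX_arc v u -> PX_arc x u ->
  exists2 t, t != u & PX_arc v t && PX_arc x t.
Proof.
move=> /PX_arcP[] // Ev Hv /PX_arcP[] // Ex Hx.
pose t := vertex u.1 (fun p => if p == k.-1 then ~~ bit u p else bit u p).
exists t.
  apply/eqP => /(congr1 (fun w => bit w k.-1)).
  by rewrite bit_vertex ?prednK // eqxx; case: (bit u k.-1).
have pk1 p : p.+1 < k -> p != k.-1 by rewrite -ltn_predRL => /ltn_eqF->.
apply/andP; split; apply/PX_arcP => //; split=> // p pk.
  by rewrite bit_vertex ?(negbTE (pk1 _ pk)) ?Hv // ltnW.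
by rewrite bit_vertex ?(negbTE (pk1 _ pk)) ?Hx // ltnW.
Qed.

(** As 2 and 4 are nonzero modulo n, [t] lies on the level of [u]; then [x] determines its bit 0 and
    [v] the other bits. *)
Lemma PX_no_square_through u v x t : PX_arc x u -> PX_arc u v ->
  PX n k t x -> PX n k t v -> t = u.
Proof.
move=> xu uv tx tv.
have Eu := PX_arc_level xu; have Ev := PX_arc_level uv.
have tv' : PX_arc t v.
  case/orP: tv => // /PX_arc_level Et; case/orP: tx => /PX_arc_level Et'.
    have /eqP[] := natr_neq0 (isT : 0 < 4 < 5).
    apply: (addrI x.1); rewrite addr0 [in RHS]Et' Et Ev Eu.
    by rewrite -!addrA.
  have /eqP[] := natr_neq0 (isT : 0 < 2 < 5).
  apply: (addrI u.1); rewrite addr0 [RHS]Eu -Et' Et Ev.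
  by rewrite -!addrA.
have Et : t.1 = u.1 by apply: (addIr 1%R); rewrite -Ev (PX_arc_level tv').
have xt : PX_arc x t.
  case/orP: tx => // /PX_arc_level E.
  have /eqP[] := natr_neq0 (isT : 0 < 2 < 5).
  by apply: (addrI x.1); rewrite addr0 [RHS]E Et Eu -addrA.
apply: vertex_ext => // -[_|p pk].
  case/PX_arcP: xt => // _ /(_ 0 k_ge2) <-.
  by case/PX_arcP: xu => // _ /(_ 0 k_ge2) <-.
by case/PX_arcP: tv' => // _ ->; case/PX_arcP: uv => // _ ->.
Qed.

(** The right-hand side speaks of adjacency only, so automorphisms respect the two sides of [u]. *)
Lemma PX_same_side u v x : PX n k u v -> PX n k u x ->
  (PX_arc u v = PX_arc u x) <->
  (exists2 t, t != u & PX n k t v && PX n k t x).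
Proof.
move=> uv ux; have uv' := PX_arcC uv; have ux' := PX_arcC ux; split.
  case Ev: (PX_arc u v) uv' ux' => /= uv' ux' Ex.
    have [t tu /andP[tv tx]] := PX_square_out Ev (esym Ex).
    by exists t => //; rewrite /PX tv tx.
  rewrite -Ex in ux'; have [t tu /andP[tv tx]] := PX_square_in uv' ux'.
  by exists t => //; rewrite /PX tv tx !orbT.
move=> [t tu /andP[tv tx]].
case Ev: (PX_arc u v) uv' => /= uv'; case Ex: (PX_arc u x) ux' => //= ux'.
  by rewrite (PX_no_square_through ux' Ev tx tv) eqxx in tu.
by rewrite (PX_no_square_through uv' Ex tv tx) eqxx in tu.
Qed.

Lemma graph_aut_same_side s u v x : s \in graph_aut (PX n k) ->
  PX n k u v -> PX n k u x ->
  (PX_arc u v == PX_arc u x) = (PX_arc (s u) (s v) == PX_arc (s u) (s x)).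
Proof.
move=> /graph_autP sP uv ux; apply/eqP/eqP.
  move/(PX_same_side uv ux) => [t tu tvx].
  apply/PX_same_side; rewrite ?sP //.
  by exists (s t); rewrite ?sP // (inj_eq perm_inj).
move/PX_same_side; rewrite !sP // => /(_ uv ux)[t tu].
rewrite -{1 2}(permKV s t) !sP => tvx; apply/PX_same_side => //.
by exists (s^-1 t)%g => //; apply: contraNneq tu => <-; rewrite permKV.
Qed.

Lemma graph_aut_orientation s : k <= n -> s \in graph_aut (PX n k) ->
  (forall u v, PX_arc u v -> PX_arc (s u) (s v)) \/
  (forall u v, PX_arc u v -> PX_arc (s v) (s u)).
Proof.
move=> kn sA; have /graph_autP sP := sA.
pose nx u := vertex (u.1 + 1)%R (fun p => bit u p.+1).
have nxP u : PX_arc u (nx u).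
  by apply/PX_arcP => //; split=> // p pk; rewrite bit_vertex // ltnW.
(* [f u] tells whether [s] keeps the direction of the arcs leaving [u], which all behave alike. *)
pose f u := PX_arc (s u) (s (nx u)).
have adj u v : PX_arc u v -> PX n k u v by rewrite /PX => ->.
have fE u v : PX_arc u v -> PX_arc (s u) (s v) = f u.
  move=> uv; apply/eqP; rewrite -graph_aut_same_side ?adj //.
  by rewrite uv nxP.
have fC u v : PX_arc u v -> f u = f v.
  move=> uv; rewrite -(fE u v) //.
  have vu : PX n k v u by rewrite PX_sym adj.
  (* The neighbors [u] and [nx v] lie on opposite sides of [v], hence so do their images. *)
  have := graph_aut_same_side sA vu (adj _ _ (nxP v)).
  rewrite nxP (negbTE (PX_arc_asym uv)) -/(f v) PX_arcC ?sP ?adj //.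
  by case: (PX_arc _ _); case: (f v).
have fC' := PX_invariant_const n_gt1 k_gt0 kn fC.
pose o := vertex 0%R (fun=> false).
case Eo: (f o); [left|right] => u v uv.
  by rewrite fE // (fC' u o).
by rewrite PX_arcC ?sP ?adj // fE // (fC' u o) Eo.
Qed.

End Orientation.

(** * Shifts with flips, and the lower bound *)

Definition shift_flip (d : 'Z_n) (h : 'Z_n -> bool) (v : V) : V :=
  vertex (v.1 + d)%R (fun p => bit v p (+) h (v.1 + p%:R)%R).

Lemma shift_flip_inj d h : injective (shift_flip d h).
Proof.
move=> u v E; have E1 : u.1 = v.1 by apply: (addIr d); apply: (congr1 fst E).
apply: vertex_ext => // p pk.
have := congr1 (fun w => bit w p) E; rewrite !bit_vertex // E1.
exact: addIb.
Qed.

Definition shift_flip_perm d h : {perm V} := perm (@shift_flip_inj d h).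

(** Flips depend on the position in Z_n before the shift, so overlapping windows undergo the same
    flips. *)
Lemma shift_flip_arc d h u v : 0 < k ->
  PX_arc (shift_flip d h u) (shift_flip d h v) = PX_arc u v.
Proof.
move=> k_gt0; apply/PX_arcP/PX_arcP => // -[E H].
  have E1 : (v.1 = u.1 + 1)%R by apply: (addIr d); rewrite [LHS]E /= addrAC.
  split=> // p pk; have := H p pk; rewrite !bit_vertex //; last exact: ltnW.
  by rewrite E1 -addrA [(1 + _)%R]addrC natr1; apply: addIb.
split=> [|p pk]; first by rewrite /= E addrAC.
rewrite !bit_vertex //; last exact: ltnW.
by rewrite H // E -addrA [(1 + _)%R]addrC natr1.
Qed.

Lemma shift_flip_aut d h : 0 < k -> shift_flip_perm d h \in graph_aut (PX n k).
Proof.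
by move=> k_gt0; apply/graph_autP => u v; rewrite /PX !permE !shift_flip_arc.
Qed.

Lemma color_class_gt c b : 1 < n -> 0 < k -> k < n ->
  distinguishing (PX n k) c -> n %/ k < #|color_class c b|.
Proof.
move=> n_gt1 k_gt0 kn dc; rewrite ltnNge; apply/negP => le_m.
set S := color_class c b in le_m.
pose pos (a : V * 'I_k) : 'Z_n := (a.1.1 + (a.2 : nat)%:R)%R.
have pos_onto j : exists2 a, a.1 \in S & pos a = j.
  suff /existsP[a /andP[aS /eqP aj]] : [exists a, (a.1 \in S) && (pos a == j)].
    by exists a.
  apply: contraT => /existsPn Nj.
  have /permP/(_ (vertex j (fun=> false))) :
      shift_flip_perm 0%R (pred1 j) = 1%g.
    apply: (distinguishing_stable (b := b) dc); first exact: shift_flip_aut.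
    move=> x xb; suff -> : shift_flip_perm 0%R (pred1 j) x = x by [].
    rewrite permE; apply: vertex_ext => [|p pk]; first by rewrite /= addr0.
    rewrite bit_vertex //=; have := Nj (x, Ordinal pk).
    by rewrite inE xb eqxx /pos /= => /negbTE->; rewrite addbF.
  rewrite permE perm1 => /(congr1 (fun w => bit w 0)).
  by rewrite !bit_vertex //= addr0 eqxx.
pose D := setX S [set: 'I_k].
have imD : pos @: D = setT.
  apply/eqP; rewrite eqEsubset subsetT /=; apply/subsetP => j _.
  have [a aS <-] := pos_onto j; apply: imset_f.
  by rewrite inE aS inE.
(* A surjection from at most n pairs onto n positions is injective: the windows of [S] are
   disjoint. *)
have /imset_injP pos_inj : #|pos @: D| == #|D|.
  have cardZ : #|[set: 'Z_n]| = n by rewrite cardsT card_ord Zp_cast.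
  rewrite eqn_leq leq_imset_card /= imD cardZ cardsX cardsT card_ord.
  by rewrite (leq_trans _ (leq_trunc_div n k)) // leq_mul2r le_m orbT.
have uniq_pos u v p q (pk : p < k) (qk : q < k) : u \in S -> v \in S ->
    (u.1 + p%:R = v.1 + q%:R)%R -> u = v /\ p = q.
  move=> uS vS E.
  have [] : (u, Ordinal pk) = (v, Ordinal qk).
    by apply: pos_inj => //; rewrite /D in_setX ?uS ?vS in_setT.
  by move=> -> ->.
pose h j := [exists a, [&& a.1 \in S, pos a == j & bit a.1 a.2]].
have hE u p : u \in S -> p < k -> h (u.1 + p%:R)%R = bit u p.
  move=> uS pk; apply/existsP/idP => [[[v q] /and3P[/= vS /eqP E]]|up].
    by have [-> ->] := uniq_pos v u _ _ (ltn_ord q) pk vS uS E.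
  by exists (u, Ordinal pk); rewrite uS up /pos eqxx.
have next u : u \in S -> exists2 v, v \in S & (v.1 = u.1 + k%:R)%R.
  move=> uS; have [[v [[|q] qk]] /= vS] := pos_onto (u.1 + k%:R)%R.
    by rewrite /pos /= addr0 => E; exists v.
  (* At index [q.+1] of [v], the preceding position would be the last one of [u]; disjointness then
     gives [v = u] and [q.+1 = k], out of range. *)
  have kE : (k%:R = k.-1%:R + 1 :> 'Z_n)%R by rewrite natr1 prednK.
  rewrite /pos /= kE -natr1 !addrA => /addIr E.
  have k1k : k.-1 < k by rewrite prednK.
  have [Evu Eq] := uniq_pos v u _ _ (ltnW qk) k1k vS uS E.
  by rewrite Eq prednK // ltnn in qk.
(* [h] is the bit pattern spelled by all tiles together; these flips turn the bits of each tile into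
   those of the next. *)
pose s := shift_flip_perm k%:R%R (fun j => h j (+) h (j + k%:R)%R).
have /permP/(_ (vertex 0%R (fun=> false))) : s = 1%g.
  apply: (distinguishing_stable (b := b) dc); first exact: shift_flip_aut.
  move=> u ub; have uS : u \in S by rewrite inE ub.
  have [v vS Ev] := next u uS.
  suff -> : s u = v by move: vS; rewrite inE => /eqP.
  rewrite permE; apply: vertex_ext => [|p pk]; first by rewrite Ev.
  rewrite bit_vertex // addbA hE // addbb addFb addrAC -Ev.
  exact: hE.
rewrite permE perm1 => /(congr1 fst) /=; rewrite add0r.
move=> /(@Zp_natr_small _ n_gt1 k 0 kn (ltnW n_gt1)) k0.
by rewrite k0 in k_gt0.
Qed.

(** * The tiling with one extra vertex, and the upper bound *)

Section Tiling.
Hypotheses (n_ge5 : 5 <= n) (k_ge2 : 2 <= k) (k_lt_n : k < n) (k_dvd_n : k %| n).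

Let n_gt1 : 1 < n. Proof. exact: leq_trans n_ge5. Qed.
Let k_gt0 : 0 < k. Proof. exact: ltnW. Qed.

Definition tile (t : nat) : V := vertex (k * t)%:R%R (fun=> false).
(** The final bit 1 blocks arcs from [extra] to a tile, whose level could match when k = 2. *)
Definition extra : V := vertex 1%R (fun p => p == k.-1).
Definition tiling : {set V} := extra |: [set tile i | i : 'I_(n %/ k)].

Lemma card_tiling : #|tiling| <= n %/ k + 1.
Proof.
rewrite cardsU1 addnC leq_add ?leq_b1 //.
by rewrite (leq_trans (leq_imset_card _ _)) // card_ord.
Qed.

Lemma tilingP u : u \in tiling -> u = extra \/ exists t : nat, u = tile t.
Proof.
by case/setU1P => [->|/imsetP[t _ ->]]; [left|right; exists t].
Qed.

Lemma tile_in (t : nat) : t < n %/ k -> tile t \in tiling.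
Proof.
move=> tm; rewrite in_setU1; apply/orP; right.
by apply/imsetP; exists (Ordinal tm).
Qed.

Lemma tile_level_neq1 (t : nat) : ((k * t)%:R != 1 :> 'Z_n)%R.
Proof.
apply/eqP => /(@Zp_natr_eq_dvd n k n_gt1 (k * t) 1 k_dvd_n).
by rewrite modnMr modn_small.
Qed.

(** Modulo k, which divides n, all tiles have level 0, so no arc joins two of them. *)
Lemma tiling_arc u v : u \in tiling -> v \in tiling -> PX_arc u v ->
  u = tile 0 /\ v = extra.
Proof.
case/tilingP=> [->|[t ->]] /tilingP[->|[t' ->]] /PX_arcP[] // E H.
- have /eqP := E; rewrite -[X in X == _]addr0 (inj_eq (addrI _)).
  by rewrite eq_sym oner_eq0.
- have kE : k.-2.+1 = k.-1 by rewrite prednK // -ltnS prednK.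
  have k2 : k.-2.+1 < k by rewrite kE prednK.
  by have := H _ k2; rewrite bit_vertex // bit_vertex ?(ltnW k2) // kE eqxx.
- split=> //; congr vertex; rewrite muln0.
  by apply: (addIr 1%R); rewrite add0r -[LHS]E.
- have := E; rewrite /= natr1 => /(@Zp_natr_eq_dvd n k n_gt1 _ _ k_dvd_n).
  by rewrite -addn1 modnMr -modnDml modnMr modn_small.
Qed.

Lemma tile_cover (i : 'Z_n) : exists t p : nat, [/\ t < n %/ k, p < k &
  (i = (k * t)%:R + p%:R :> 'Z_n)%R].
Proof.
have i_n : i < n by have := ltn_ord i; rewrite [X in _ < X -> _]Zp_cast.
exists (i %/ k), (i %% k); split.
- by rewrite ltn_divRL // (leq_ltn_trans (leq_trunc_div _ _)).
- by rewrite ltn_mod.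
- by rewrite -natrD mulnC -divn_eq [RHS]natr_Zp.
Qed.

Lemma distinguishing_tiling :
  distinguishing (PX n k) [ffun v => v \in tiling].
Proof.
apply: distinguishing_set => s sA sS.
have sIn u : u \in tiling -> s u \in tiling by rewrite sS.
have m_gt1 : 1 < n %/ k by rewrite ltn_divRL // mul1n.
have t0S := tile_in (ltnW m_gt1).
have xS : extra \in tiling by rewrite in_setU1 eqxx.
have t0x : PX_arc (tile 0) extra.
  apply/PX_arcP => //; split=> [|p pk]; first by rewrite /= muln0 add0r.
  rewrite !bit_vertex //; last exact: ltnW.
  by rewrite -ltn_predRL in pk; rewrite ltn_eqF.
have [sP|sP] := graph_aut_orientation n_ge5 k_ge2 (ltnW k_lt_n) sA; last first.
  have [_ Et0] := tiling_arc (sIn _ xS) (sIn _ t0S) (sP _ _ t0x).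
  have lev u v : PX_arc u v -> ((s u).1 + u.1 = (s v).1 + v.1)%R.
    move=> uv; rewrite (PX_arc_level uv) (PX_arc_level (sP _ _ uv)).
    by rewrite addrAC addrA.
  have := PX_invariant_const n_gt1 k_gt0 (ltnW k_lt_n) lev (tile 0) (tile 1).
  rewrite Et0 /= muln0 addr0 muln1.
  have [->|[t ->]] := tilingP (sIn _ (tile_in m_gt1)) => /= /eqP.
    rewrite -[X in X == _]addr0 (inj_eq (addrI _)) eq_sym.
    move=> /eqP /(@Zp_natr_small n n_gt1 k 0 k_lt_n (ltnW n_gt1)) k0.
    by have := k_gt0; rewrite [X in 0 < X]k0.
  by rewrite -natrD -mulnSr eq_sym (negbTE (tile_level_neq1 _)).
have [Et0 _] := tiling_arc (sIn _ t0S) (sIn _ xS) (sP _ _ t0x).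
have lev u : (s u).1 = u.1.
  have levP x y : PX_arc x y -> ((s x).1 - x.1 = (s y).1 - y.1)%R.
    move=> xy; rewrite (PX_arc_level xy) (PX_arc_level (sP _ _ xy)).
    by rewrite opprD addrACA subrr addr0.
  have := PX_invariant_const n_gt1 k_gt0 (ltnW k_lt_n) levP u (tile 0).
  by rewrite Et0 subrr => /eqP; rewrite subr_eq0 => /eqP.
(* A tile is the only vertex of the tiling on its level. *)
have sT (t : nat) : t < n %/ k -> s (tile t) = tile t.
  move=> tm; have := lev (tile t).
  have [->|[t' ->]] := tilingP (sIn _ (tile_in tm)) => /= E.
    by have := tile_level_neq1 t; rewrite -E eqxx.
  by rewrite /tile E.
(* A 0 bit is compared with the fixed zero tile that covers its position. *)
have s_false u p : p < k -> bit u p = false -> bit (s u) p = false.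
  move=> pk up; have [t [q [tm qk E]]] := tile_cover (u.1 + p%:R)%R.
  rewrite (bit_morph (v := tile t) k_gt0 sP pk qk E) ?sT ?bit_vertex //.
apply/permP => u; rewrite perm1; apply: vertex_ext => // p pk.
case up: (bit u p); last exact: s_false.
(* Since 0 bits stay 0, the preimage of the all-ones vertex has bit [p] equal to 1; it is the
   reference for 1 bits. *)
pose y := (s^-1 (vertex u.1 (fun=> true)))%g.
have sy : s y = vertex u.1 (fun=> true) by rewrite permKV.
have yp : bit y p = true.
  by apply: contraT => /negbTE /(s_false _ _ pk); rewrite sy bit_vertex.
rewrite (bit_morph (v := y) k_gt0 sP pk pk) ?up ?yp //.
  by rewrite sy bit_vertex.
by rewrite -(lev y) sy.
Qed.

End Tiling.
End PraegerXu.

(** * The exact cost when k divides n *)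

Theorem theorem6p3 (n k : nat) (hn : 5 <= n) (hk : 2 <= k) (hkn : k < n)
    (hdvd : k %| n) :
  ((rho (PX n k))%:Z = Num.ceil (n%:R / k%:R : rat) + 1)%R /\
  rho (PX n k) = n %/ k + 1.
Proof.
have k_gt0 : 0 < k by apply: ltnW.
have n_gt1 : 1 < n by apply: leq_trans hn.
have rhoE : rho (PX n k) = n %/ k + 1.
  apply/eqP; rewrite eqn_leq; apply/andP; split.
    have dT := distinguishing_tiling hn hk hkn hdvd.
    apply: leq_trans (rho_le true dT) (leq_trans _ (card_tiling n k)).
    by apply: subset_leq_card; apply/subsetP => v; rewrite inE ffunE => /eqP->.
  have [c dc [b ->]] := rho_attained (distinguishing_tiling hn hk hkn hdvd).
  by rewrite addn1 color_class_gt.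
split=> //; rewrite rhoE -[n in (n%:R)%R](divnK hdvd) natrM mulfK.
  by rewrite -[((n %/ k)%:R)%R]/((n %/ k)%:Z%:~R)%R Num.Theory.intrKceil PoszD.
by rewrite Num.Theory.pnatr_eq0 -lt0n.
Qed.
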